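(* Let $d=p^2+4q$. For all non-negative integers $n$ and $k$, $$\sum_{j=0}^{n}\binom{n}{j}q^{n-j}W_{2j+k}=\begin{cases} d^{\frac{n}{2}}W_{n+k}, & \text{if } n \text{ is even};\\ d^{\frac{n-1}{2}}\left(W_{n+k+1}+qW_{n+k-1}\right), & \text{if } n \text{ is odd}.\end{cases}$$
   Context: Let $H$ be the real quaternion algebra with basis $1,i,j,k$ and (non-commutative) multiplication determined by $i^2=j^2=k^2=-1$, $ij=-ji=k$, $jk=-kj=i$, $ki=-ik=j$; real scalars commute with all quaternions. Fix real numbers $p,q$. The Horadam sequence $w_n=w_n(w_0,w_1;p,q)$ has real initial values $w_0,w_1$ and satisfies $w_n=pw_{n-1}+qw_{n-2}$ for $n\ge 2$. The Horadam quaternions are $W_n=w_n+w_{n+1}i+w_{n+2}j+w_{n+3}k$. *)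

(* Defs.v *)
From HB Require Import structures.
From mathcomp Require Import all_boot all_order all_algebra.
From mathcomp Require Import ring.
From mathcomp Require Export reals.

Set Implicit Arguments.
Unset Strict Implicit.
Unset Printing Implicit Defensive.

Import GRing.Theory.
Local Open Scope ring_scope.

(* [Quat a b c d] stands for a + b i + c j + d k. *)
Record quat (R : Type) : Type := Quat { qre : R; qi : R; qj : R; qk : R }.

Section QuatChoice.
Variable R : Type.

Definition quat_to_tuple (x : quat R) := (qre x, qi x, qj x, qk x).
Definition quat_of_tuple (t : R * R * R * R) : quat R :=
  let: (a, b, c, d) := t in Quat a b c d.

Lemma quat_to_tupleK : cancel quat_to_tuple quat_of_tuple.
Proof. by case. Qed.
End QuatChoice.

HB.instance Definition _ (R : choiceType) :=
  Choice.copy (quat R) (can_type (@quat_to_tupleK R)).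

Section QuatAlgebra.
Variable R : comNzRingType.
Implicit Types x y z : quat R.

Definition quat_add x y : quat R :=
  Quat (qre x + qre y) (qi x + qi y) (qj x + qj y) (qk x + qk y).
Definition quat_opp x : quat R := Quat (- qre x) (- qi x) (- qj x) (- qk x).
Definition quat_zero : quat R := Quat 0 0 0 0.
Definition quat_one : quat R := Quat 1 0 0 0.
Definition quat_mul x y : quat R :=
  Quat (qre x * qre y - qi x * qi y - qj x * qj y - qk x * qk y)
       (qre x * qi y + qi x * qre y + qj x * qk y - qk x * qj y)
       (qre x * qj y - qi x * qk y + qj x * qre y + qk x * qi y)
       (qre x * qk y + qi x * qj y - qj x * qi y + qk x * qre y).
Definition quat_scale (a : R) x : quat R :=
  Quat (a * qre x) (a * qi x) (a * qj x) (a * qk x).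

Fact quat_addA : associative quat_add.
Proof. by move=> [????] [????] [????]; rewrite /quat_add /=; congr Quat; ring. Qed.
Fact quat_addC : commutative quat_add.
Proof. by move=> [????] [????]; rewrite /quat_add /=; congr Quat; ring. Qed.
Fact quat_add0 : left_id quat_zero quat_add.
Proof. by move=> [????]; rewrite /quat_add /=; congr Quat; ring. Qed.
Fact quat_addN : left_inverse quat_zero quat_opp quat_add.
Proof. by move=> [????]; rewrite /quat_add /=; congr Quat; ring. Qed.

HB.instance Definition _ := GRing.isZmodule.Build (quat R)
  quat_addA quat_addC quat_add0 quat_addN.

Fact quat_mulA : associative quat_mul.
Proof. by move=> [????] [????] [????]; rewrite /quat_mul /=; congr Quat; ring. Qed.
Fact quat_mul1l : left_id quat_one quat_mul.
Proof. by move=> [????]; rewrite /quat_mul /=; congr Quat; ring. Qed.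
Fact quat_mul1r : right_id quat_one quat_mul.
Proof. by move=> [????]; rewrite /quat_mul /=; congr Quat; ring. Qed.
Fact quat_mulDl : left_distributive quat_mul +%R.
Proof.
by move=> [????] [????] [????]; rewrite /quat_mul /=; congr Quat => /=; ring.
Qed.
Fact quat_mulDr : right_distributive quat_mul +%R.
Proof.
by move=> [????] [????] [????]; rewrite /quat_mul /=; congr Quat => /=; ring.
Qed.
Fact quat_one_neq0 : quat_one != 0.
Proof. by apply/eqP => -[] /eqP; rewrite oner_eq0. Qed.

HB.instance Definition _ := GRing.Zmodule_isNzRing.Build (quat R)
  quat_mulA quat_mul1l quat_mul1r quat_mulDl quat_mulDr quat_one_neq0.

Fact quat_scaleA (a b : R) x :
  quat_scale a (quat_scale b x) = quat_scale (a * b) x.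
Proof. by case: x => ????; rewrite /quat_scale /=; congr Quat; ring. Qed.
Fact quat_scale1 : left_id 1 quat_scale.
Proof. by move=> [????]; rewrite /quat_scale /=; congr Quat; ring. Qed.
Fact quat_scaleDr : right_distributive quat_scale +%R.
Proof. by move=> a [????] [????]; rewrite /quat_scale /=; congr Quat => /=; ring. Qed.
Fact quat_scaleDl x : {morph quat_scale^~ x : a b / a + b}.
Proof. by case: x => ???? a b; rewrite /quat_scale /=; congr Quat => /=; ring. Qed.

HB.instance Definition _ := GRing.Zmodule_isLmodule.Build R (quat R)
  quat_scaleA quat_scale1 quat_scaleDr quat_scaleDl.

Fact quat_scaleAl (a : R) x y : a *: (x * y) = a *: x * y.
Proof.
case: x => ????; case: y => ????; rewrite /GRing.scale /GRing.mul /=.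
by rewrite /quat_scale /quat_mul /=; congr Quat; ring.
Qed.
Fact quat_scaleAr (a : R) x y : a *: (x * y) = x * (a *: y).
Proof.
case: x => ????; case: y => ????; rewrite /GRing.scale /GRing.mul /=.
by rewrite /quat_scale /quat_mul /=; congr Quat; ring.
Qed.

HB.instance Definition _ := GRing.Lmodule_isLalgebra.Build R (quat R) quat_scaleAl.
HB.instance Definition _ := GRing.Lalgebra_isAlgebra.Build R (quat R) quat_scaleAr.

Definition Hi : quat R := Quat 0 1 0 0.
Definition Hj : quat R := Quat 0 0 1 0.
Definition Hk : quat R := Quat 0 0 0 1.

Lemma quatE (a b c d : R) :
  Quat a b c d = a%:A + b *: Hi + c *: Hj + d *: Hk.
Proof. by congr Quat => /=; ring. Qed.

Lemma quat_mul_table :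
  [/\ Hi * Hi = -1, Hj * Hj = -1 & Hk * Hk = -1] /\
  [/\ Hi * Hj = Hk, Hj * Hk = Hi & Hk * Hi = Hj] /\
  [/\ Hj * Hi = - Hk, Hk * Hj = - Hi & Hi * Hk = - Hj].
Proof. by do ![split]; congr Quat => /=; ring. Qed.

End QuatAlgebra.

Arguments Hi {R}.
Arguments Hj {R}.
Arguments Hk {R}.

Fixpoint horadam (R : comNzRingType) (w0 w1 p q : R) (n : nat) : R :=
  match n with
  | 0 => w0
  | m.+1 => match m with
            | 0 => w1
            | l.+1 => p * horadam w0 w1 p q m + q * horadam w0 w1 p q l
            end
  end.

Definition horadamQ (R : comNzRingType) (w0 w1 p q : R) (n : nat) : quat R :=
  let w := horadam w0 w1 p q in
  (w n)%:A + w n.+1 *: Hi + w n.+2 *: Hj + w n.+3 *: Hk.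

(* Main.v *)
(** The sum is the binomial expansion of [(E ^ 2 + q) ^ n], with [E] the shift
    operator, applied to [W] at index [k].  On solutions of the recurrence
    [E ^ 2 = p E + q], hence
    [(E ^ 2 + q) ^ 2 = (E ^ 2 - q) ^ 2 + 4 q E ^ 2 = (p ^ 2 + 4 q) E ^ 2]. *)
Require Import Defs.
From mathcomp Require Import all_boot all_order all_algebra.
From mathcomp Require Import reals ring zify.

Import GRing.Theory.
Local Open Scope ring_scope.

Section BinomialTransform.
Variables (R : comNzRingType) (V : lmodType R) (p q : R) (u : nat -> V).

Definition binomial_shift_sum (n k : nat) : V :=
  \sum_(0 <= j < n.+1) ('C(n, j)%:R * q ^+ (n - j)) *: u (2 * j + k)%N.

Lemma binomial_shift_sum0 k : binomial_shift_sum 0 k = u k.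
Proof. by rewrite /binomial_shift_sum big_nat1 mulr1 scale1r. Qed.

(** Pascal's rule, which splits off one factor [E ^ 2 + q]. *)
Lemma binomial_shift_sumS n k :
  binomial_shift_sum n.+1 k =
    binomial_shift_sum n k.+2 + q *: binomial_shift_sum n k.
Proof.
(* The range may grow to [j = n.+1]: that term vanishes because ['C(n, n.+1) = 0]. *)
have qE : q *: binomial_shift_sum n k =
    \sum_(0 <= j < n.+2) ('C(n, j)%:R * q ^+ (n.+1 - j)) *: u (2 * j + k)%N.
  rewrite [RHS]big_nat_recr //= bin_small // mul0r scale0r addr0.
  rewrite /binomial_shift_sum scaler_sumr; apply: eq_big_nat => j /andP[_ jn].
  by rewrite scalerA subSn // exprS; congr (_ *: _); ring.
rewrite qE big_nat_recl // /binomial_shift_sum [LHS]big_nat_recl //=.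
rewrite !bin0 addrCA; congr (_ + _).
rewrite -big_split /=; apply: eq_big_nat => j _.
have -> : (2 * j + k.+2 = 2 * j.+1 + k)%N by lia.
by rewrite -scalerDl binS natrD subSS; congr (_ *: _); ring.
Qed.

Hypothesis u_rec : forall n, u n.+2 = p *: u n.+1 + q *: u n.

Lemma recurrence_shift_sqr n :
  (u n.+4 + q *: u n.+2) + q *: (u n.+2 + q *: u n) =
    (p ^+ 2 + 4 * q) *: u n.+2.
Proof.
(* Solving backwards for [q *: u n] leaves only [u n.+2] and [u n.+1]; the two terms in
   [(p * q) *: u n.+1] then cancel. *)
have quE : q *: u n = u n.+2 - p *: u n.+1 by rewrite u_rec addrC addKr.
rewrite quE (u_rec n.+2) (u_rec n.+1) !scalerDr !scalerN !scalerA.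
have -> : p ^+ 2 + 4 * q = p * p + q + q + q + q by ring.
by rewrite !scalerDl (mulrC q p) !addrA !(addrAC _ ((p * q) *: _)) subrK.
Qed.

Lemma binomial_shift_sum_double m k :
  binomial_shift_sum m.*2 k = (p ^+ 2 + 4 * q) ^+ m *: u (m.*2 + k)%N.
Proof.
(* [k] stays general: two Pascal steps call the hypothesis at [k.+4], [k.+2] and [k]. *)
elim: m k => [|m IHm] k; first by rewrite binomial_shift_sum0 scale1r.
rewrite doubleS !binomial_shift_sumS !IHm !addnS !addSn (exprSr _ m) -scalerA.
rewrite -recurrence_shift_sqr !scalerDr !scalerA.
by congr (_ + _ *: _ + (_ *: _ + _ *: _)); ring.
Qed.

(** One factor [E ^ 2 + q] is left over from the squares and acts on the even case. *)
Lemma binomial_shift_sum_doubleS m k :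
  binomial_shift_sum m.*2.+1 k =
    (p ^+ 2 + 4 * q) ^+ m *: (u (m.*2 + k).+2 + q *: u (m.*2 + k)%N).
Proof.
rewrite binomial_shift_sumS !binomial_shift_sum_double !addnS scalerDr !scalerA.
by congr (_ + _ *: _); ring.
Qed.

End BinomialTransform.

(** In coordinates, via [quatE], each component is the scalar recurrence and holds by
    computation. *)
Lemma horadamQ_rec (R : comNzRingType) (w0 w1 p q : R) n :
  horadamQ w0 w1 p q n.+2 =
    p *: horadamQ w0 w1 p q n.+1 + q *: horadamQ w0 w1 p q n.
Proof. by rewrite /horadamQ -!quatE. Qed.

Theorem theorem3p3 (R : realType) (w0 w1 p q : R) (n k : nat) :
  let W := horadamQ w0 w1 p q in
  let d := p ^+ 2 + 4 * q in
  \sum_(0 <= j < n.+1) ('C(n, j)%:R * q ^+ (n - j)) *: W (2 * j + k)%N =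
    if ~~ odd n then d ^+ (n %/ 2) *: W (n + k)%N
    else d ^+ ((n - 1) %/ 2) *: (W (n + k + 1)%N + q *: W (n + k - 1)%N).
Proof.
move=> W d; rewrite -/(binomial_shift_sum _ _ q W n k).
have W_rec := @horadamQ_rec R w0 w1 p q.
case: ifP => n_odd.
  have nE : n = n./2.*2 by lia.
  by rewrite {1}nE (binomial_shift_sum_double _ _ _ _ _ W_rec) -nE divn2.
have nE : n = n./2.*2.+1 by lia.
rewrite {1}nE (binomial_shift_sum_doubleS _ _ _ _ _ W_rec).
have -> : ((n - 1) %/ 2 = n./2)%N by lia.
have -> : (n + k + 1 = (n./2.*2 + k).+2)%N by lia.
(* Since [n] is odd, [n + k] is positive even for [k = 0], so the truncated subtraction is exact. *)
by have -> : (n + k - 1 = n./2.*2 + k)%N by lia.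
Qed.
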